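(* Let $L(1)=1$, $L(2)=3$, and $L(n)=L(n-1)+L(n-2)$ for $n>2$ be the Lucas numbers. Then Catalan's constant $G$ has the series acceleration formula $$G = \frac{\pi}{8}\log\left(\frac{10+\sqrt{50-22\sqrt5}}{10-\sqrt{50-22\sqrt5}}\right) + \frac{5}{8}\sum_{k=0}^\infty\frac{L(2k+1)}{(2k+1)^2\binom{2k}{k}}.$$
   Context: Catalan's constant is $G := \sum_{k=0}^\infty \frac{(-1)^k}{(2k+1)^2}$. *)

(* Defs.v *)
From Stdlib Require Import Reals Lra Lia.
From Coquelicot Require Import Coquelicot.
Open Scope R_scope.

Definition catalan_term (k : nat) : R :=
  (-1) ^ k / (2 * INR k + 1) ^ 2.

Definition catalan : R := Series catalan_term.

(* [Series] is total, so convergence has to be checked separately. *)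
Lemma ex_series_catalan_term : ex_series catalan_term.
Proof.
apply (ex_series_le (V := R_CompleteNormedModule) catalan_term
         (fun k => 2 * (/ (INR k + 1) - / (INR k + 2)))).
- intros k; unfold catalan_term.
  pose proof (pos_INR k) as Hk.
  change (Rabs ((-1) ^ k / (2 * INR k + 1) ^ 2)
          <= 2 * (/ (INR k + 1) - / (INR k + 2))).
  assert (Hd : 0 < (2 * INR k + 1) ^ 2) by (apply pow_lt; lra).
  unfold Rdiv; rewrite Rabs_mult, pow_1_abs, Rmult_1_l.
  rewrite Rabs_pos_eq by (left; apply Rinv_0_lt_compat, Hd).
  replace (2 * (/ (INR k + 1) - / (INR k + 2)))
    with (/ ((INR k + 1) * (INR k + 2) / 2)) by (field; lra).
  apply Rinv_le_contravar; nra.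
- exists 2.
  change (is_lim_seq
    (sum_n (fun k => 2 * (/ (INR k + 1) - / (INR k + 2)))) 2).
  apply is_lim_seq_ext with (fun n => 2 - 2 * / (INR n + 2)).
  + intros n; induction n as [|n IH].
    * rewrite sum_O; simpl; field.
    * rewrite sum_Sn, <- IH, S_INR.
      pose proof (pos_INR n).
      unfold plus; simpl; field; lra.
  + replace (Finite 2) with (Finite (2 - 2 * 0)) by (f_equal; ring).
    apply is_lim_seq_minus'; [apply is_lim_seq_const|].
    apply (is_lim_seq_scal_l _ 2 0).
    apply (is_lim_seq_inv (fun n => INR n + 2) p_infty); [|easy].
    apply (is_lim_seq_plus _ _ p_infty 2);
      [apply is_lim_seq_INR | apply is_lim_seq_const | easy].
Qed.

(* The recurrence extended down to index 0 forces the value 2 there. *)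
Fixpoint lucas (n : nat) : nat :=
  match n with
  | O => 2
  | S p => match p with
           | O => 1
           | S q => lucas p + lucas q
           end
  end.

Lemma lucas_spec :
  lucas 1 = 1%nat /\ lucas 2 = 3%nat /\
  (forall n : nat, (2 < n)%nat -> lucas n = (lucas (n - 1) + lucas (n - 2))%nat).
Proof.
split; [reflexivity | split; [reflexivity |]].
intros [|[|n]] Hn; try lia.
replace (S (S n) - 1)%nat with (S n) by lia.
replace (S (S n) - 2)%nat with n by lia.
reflexivity.
Qed.

(* [Binomial.C] is qualified because Coquelicot rebinds [C] to the complex
   numbers. *)
Definition lucas_term (k : nat) : R :=
  INR (lucas (2 * k + 1)) / ((2 * INR k + 1) ^ 2 * Binomial.C (2 * k) k).

(* Main.v *)
Require Import Defs.
From Stdlib Require Import Reals Factorial Lra Lia Nsatz.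
From Coquelicot Require Import Coquelicot.
Open Scope R_scope.

(** Both sides of the formula are values of one function, the inverse tangent
    integral [Ti2 x = sum (-1)^k x^(2k+1) / (2k+1)^2], read in the angle:
    [ti2_tan t = Ti2 (tan t)].  Its derivative is [2 t / sin (2 t)], and
    Catalan's constant is its limit as [t] tends to [PI / 4].

    On the series side,
    [sum 4^k (sin t)^(2k+1) / ((2k+1)^2 C(2k,k))] has derivative
    [t / sin t] in [t], because [sum 4^k y^(2k+1) / ((2k+1) C(2k,k))] is
    [asin y / sqrt (1 - y^2)]; so it equals [2 ti2_tan (t / 2)]
    ([odd_pseries_asin_sqr]).  The golden ratio and its inverse are
    [2 sin (3 PI / 10)] and [2 sin (PI / 10)], so Binet's formula turns the
    Lucas series into
    [4 (ti2_tan (3 PI / 20) - ti2_tan (PI / 20))] ([is_series_lucas_term]).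

    On the side of Catalan's constant, the partial fraction expansion of
    [5 / sin (5 x)] ([inv_sin_5a]) integrates to a linear relation between
    [ti2_tan (5 t)] and the values of [ti2_tan] at five other angles, up to
    logarithms of tangents ([quintuple_relation]).  As [t] tends to
    [PI / 20], the angles [5 t] and [PI / 5 + t] tend to [PI / 4] and the four
    others pair up at [PI / 20] and [3 PI / 20].  This expresses
    Catalan's constant by the same difference as above and the logarithm of
    [tan (PI / 20) / tan (3 PI / 20) ^ 3] ([catalan_ti2_tan]); that
    quotient is evaluated in [tan_PI20_div_cube]. *)

(** * Odd power series *)

Lemma eq_of_derive_zero (f : R -> R) (a b x y : R) :
  (forall t, a < t < b -> is_derive f t 0) ->
  a < x < b -> a < y < b -> f x = f y.
Proof.
intros Hf Hx Hy.
destruct (Rtotal_order x y) as [H | [-> | H]]; [| reflexivity | symmetry];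
  (apply (eq_is_derive (V := R_NormedModule)); [| exact H]);
  intros t Ht; apply Hf; lra.
Qed.

Lemma CV_radius_ge_1_of_bounded (p : nat -> R) (M : R) :
  (forall k, Rabs (p k) <= M) -> Rbar_le 1 (CV_radius p).
Proof.
intros HM.
apply (proj1 (CV_radius_bounded p)).
exists M; intros k; rewrite pow1, Rmult_1_r; apply HM.
Qed.

Lemma Rabs_sqr_lt_1 (y : R) : -1 < y < 1 -> Rabs (y ^ 2) < 1.
Proof. intros Hy; rewrite Rabs_pos_eq; nra. Qed.

Lemma in_disk (p : nat -> R) (z : R) :
  Rbar_le 1 (CV_radius p) -> Rabs z < 1 -> Rbar_lt (Rabs z) (CV_radius p).
Proof. intros Hp Hz; apply Rbar_lt_le_trans with 1; [exact Hz | exact Hp]. Qed.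

(** All the series below have only odd powers.  Keeping the power series in the
    variable [y ^ 2] makes their differentiation multiply coefficient [k] by
    [2 k + 1], which is [odd_derive]. *)
Definition odd_pseries (p : nat -> R) (y : R) : R := y * PSeries p (y ^ 2).

Definition odd_derive (p : nat -> R) (k : nat) : R := (2 * INR k + 1) * p k.

(** The product rule for [y * P (y ^ 2)] gives [P z + 2 z P' z] at
    [z = y ^ 2]. *)
Lemma is_pseries_odd_derive (p : nat -> R) (z : R) :
  Rbar_le 1 (CV_radius p) -> Rabs z < 1 ->
  is_pseries (odd_derive p) z
    (PSeries p z + 2 * (z * PSeries (PS_derive p) z)).
Proof.
intros Hp Hz.
pose proof (in_disk p z Hp Hz) as Hin.
apply is_pseries_ext with
  (PS_plus p (PS_scal 2 (PS_incr_1 (PS_derive p)))).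
- intros [|k]; unfold PS_plus, PS_scal, PS_incr_1, PS_derive, odd_derive,
    plus, scal, zero, mult; cbn -[INR]; unfold mult; cbn -[INR].
  + simpl; ring.
  + ring.
- apply (is_pseries_plus (K := R_AbsRing) (V := R_NormedModule)).
  + apply PSeries_correct, CV_radius_inside, Hin.
  + apply (is_pseries_scal (K := R_AbsRing) (V := R_NormedModule)).
    { apply Rmult_comm. }
    apply (is_pseries_incr_1 (K := R_AbsRing) (V := R_NormedModule)).
    apply PSeries_correct, ex_pseries_derive, Hin.
Qed.

Lemma ex_pseries_odd_derive (p : nat -> R) (z : R) :
  Rbar_le 1 (CV_radius p) -> Rabs z < 1 -> ex_pseries (odd_derive p) z.
Proof. intros Hp Hz; eexists; apply is_pseries_odd_derive; assumption. Qed.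

Lemma is_derive_odd_pseries (p : nat -> R) (y : R) :
  Rbar_le 1 (CV_radius p) -> -1 < y < 1 ->
  is_derive (odd_pseries p) y (PSeries (odd_derive p) (y ^ 2)).
Proof.
intros Hp Hy.
pose proof (Rabs_sqr_lt_1 y Hy) as Hz.
pose proof (is_derive_PSeries p (y ^ 2) (in_disk p _ Hp Hz)) as Hd.
rewrite (is_pseries_unique _ _ _ (is_pseries_odd_derive p (y ^ 2) Hp Hz)).
unfold odd_pseries.
auto_derive.
- eexists; exact Hd.
- change (fun x : R => PSeries p x) with (PSeries p).
  replace (y * (y * 1)) with (y ^ 2) by ring.
  rewrite (is_derive_unique _ _ _ Hd); ring.
Qed.

(** * The inverse tangent integral *)

Definition atan_coef (k : nat) : R := (-1) ^ k / (2 * INR k + 1).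

Lemma odd_index_ge_1 (k : nat) : 1 <= 2 * INR k + 1.
Proof. pose proof (pos_INR k); lra. Qed.

Lemma CV_radius_atan_coef : Rbar_le 1 (CV_radius atan_coef).
Proof.
apply (CV_radius_ge_1_of_bounded _ 1); intros k; unfold atan_coef, Rdiv.
pose proof (odd_index_ge_1 k).
rewrite Rabs_mult, pow_1_abs, Rmult_1_l, Rabs_pos_eq.
- rewrite <- Rinv_1; apply Rinv_le_contravar; lra.
- left; apply Rinv_0_lt_compat; lra.
Qed.

(** The radius has to be known exactly, since Abel's theorem is applied at the
    end of the disk of convergence. *)
Lemma CV_radius_catalan_term : CV_radius catalan_term = Finite 1.
Proof.
replace (Finite 1) with (Finite (/ 1)) by (f_equal; field).
apply CV_radius_finite_DAlembert; [| lra |].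
- intros k; unfold catalan_term.
  pose proof (odd_index_ge_1 k).
  apply Rmult_integral_contrapositive; split.
  + apply pow_nonzero; lra.
  + apply Rinv_neq_0_compat, pow_nonzero; lra.
- apply is_lim_seq_ext with (fun k => (1 - 2 * / (2 * INR k + 3)) ^ 2).
  + intros k; unfold catalan_term.
    pose proof (odd_index_ge_1 k).
    rewrite S_INR.
    replace ((-1) ^ S k / (2 * (INR k + 1) + 1) ^ 2 / ((-1) ^ k / (2 * INR k + 1) ^ 2))
      with (- (1 - 2 * / (2 * INR k + 3)) ^ 2).
    2: { assert ((-1) ^ k <> 0) by (apply pow_nonzero; lra).
         simpl ((-1) ^ S k); field; repeat split; lra. }
    rewrite Rabs_Ropp, Rabs_pos_eq; [reflexivity | apply pow2_ge_0].
  + assert (H : is_lim_seq (fun k => 1 - 2 * / (2 * INR k + 3)) 1).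
    { replace (Finite 1) with (Finite (1 - 2 * 0)) by (f_equal; ring).
      apply is_lim_seq_minus'; [apply is_lim_seq_const |].
      apply (is_lim_seq_scal_l _ 2 0).
      apply (is_lim_seq_inv (fun n => 2 * INR n + 3) p_infty); [| easy].
      apply (is_lim_seq_plus _ _ p_infty 3);
        [| apply is_lim_seq_const | easy].
      apply is_lim_seq_ext with (fun n => INR (2 * n)).
      { intros n; rewrite mult_INR; reflexivity. }
      apply (is_lim_seq_subseq INR p_infty (fun n => (2 * n)%nat)).
      - apply eventually_subseq; intros n; lia.
      - apply is_lim_seq_INR. }
    replace (Finite 1) with (Finite (1 * (1 * 1))) by (f_equal; ring).
    apply is_lim_seq_ext with
      (fun k => (1 - 2 * / (2 * INR k + 3)) * (1 - 2 * / (2 * INR k + 3))).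
    { intros; ring. }
    rewrite Rmult_1_l; apply is_lim_seq_mult'; exact H.
Qed.

Lemma CV_radius_ge_1_catalan_term : Rbar_le 1 (CV_radius catalan_term).
Proof. rewrite CV_radius_catalan_term; apply Rle_refl. Qed.

Lemma odd_derive_catalan_term (k : nat) :
  odd_derive catalan_term k = atan_coef k.
Proof.
pose proof (odd_index_ge_1 k).
unfold odd_derive, catalan_term, atan_coef; field; lra.
Qed.

(** The geometric series: its coefficients satisfy [q (S k) = - q k], so
    splitting off the constant term gives [q = 1 - z q]. *)
Lemma PSeries_odd_derive_atan_coef (z : R) :
  Rabs z < 1 -> PSeries (odd_derive atan_coef) z * (1 + z) = 1.
Proof.
intros Hz.
assert (Hq : forall k, odd_derive atan_coef k = (-1) ^ k).
{ intros k; pose proof (odd_index_ge_1 k).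
  unfold odd_derive, atan_coef; field; lra. }
pose proof (PSeries_decr_1 (odd_derive atan_coef) z
  (ex_pseries_odd_derive _ _ CV_radius_atan_coef Hz)) as H.
rewrite (PSeries_ext (PS_decr_1 _) (PS_scal (-1) (odd_derive atan_coef))),
  PSeries_scal, Hq in H.
- simpl in H; lra.
- intros k; unfold PS_decr_1, PS_scal; rewrite !Hq; reflexivity.
Qed.

Lemma tan_bound (t : R) : - (PI / 4) < t < PI / 4 -> -1 < tan t < 1.
Proof.
pose proof PI_RGT_0.
intros Ht.
assert (Hl : tan (- (PI / 4)) < tan t) by (apply tan_increasing; lra).
assert (Hr : tan t < tan (PI / 4)) by (apply tan_increasing; lra).
rewrite tan_neg, tan_PI4 in Hl; rewrite tan_PI4 in Hr; lra.
Qed.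

(** Composed with [tan], the arctangent series has derivative [1] and vanishes
    at [0]. *)
Lemma odd_pseries_atan (t : R) :
  - (PI / 4) < t < PI / 4 -> odd_pseries atan_coef (tan t) = t.
Proof.
intros Ht.
pose proof PI_RGT_0.
apply Rminus_diag_uniq.
transitivity (odd_pseries atan_coef (tan 0) - 0).
- apply (eq_of_derive_zero (fun s => odd_pseries atan_coef (tan s) - s)
    (- (PI / 4)) (PI / 4)); [| exact Ht | lra].
  intros s Hs.
  pose proof (tan_bound s Hs) as Hb.
  replace 0 with ((tan s ^ 2 + 1) * PSeries (odd_derive atan_coef) (tan s ^ 2) - 1).
  + apply (is_derive_minus (K := R_AbsRing) (V := R_NormedModule)
      (fun s => odd_pseries atan_coef (tan s)) (fun s => s)).
    * apply (is_derive_comp (K := R_AbsRing) (V := R_NormedModule)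
               (odd_pseries atan_coef) tan).
      -- apply is_derive_odd_pseries; [apply CV_radius_atan_coef | exact Hb].
      -- apply is_derive_tan, Rgt_not_eq, cos_gt_0; lra.
    * apply (is_derive_id (K := R_AbsRing)).
  + pose proof (PSeries_odd_derive_atan_coef _ (Rabs_sqr_lt_1 _ Hb)); lra.
- rewrite tan_0; unfold odd_pseries; ring.
Qed.

Lemma tan_sqr_plus_1 (t : R) : cos t <> 0 -> tan t ^ 2 + 1 = / cos t ^ 2.
Proof.
intros Hc.
pose proof (sin2_cos2 t) as H2; unfold Rsqr in H2.
unfold tan; field_simplify_eq; [lra | exact Hc].
Qed.

Definition ti2_tan (t : R) : R := odd_pseries catalan_term (tan t).

(** The derivative of [ti2_tan] is kept as a power series, which, unlike
    [2 t / sin (2 t)], has the right value at [t = 0]. *)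
Definition ti2_tan' (t : R) : R :=
  (tan t ^ 2 + 1) * PSeries atan_coef (tan t ^ 2).

Lemma is_derive_ti2_tan (t : R) :
  - (PI / 4) < t < PI / 4 -> is_derive ti2_tan t (ti2_tan' t).
Proof.
intros Ht.
pose proof PI_RGT_0.
apply (is_derive_comp (K := R_AbsRing) (V := R_NormedModule)
         (odd_pseries catalan_term) tan).
- rewrite <- (PSeries_ext _ _ _ odd_derive_catalan_term).
  apply is_derive_odd_pseries;
    [apply CV_radius_ge_1_catalan_term | apply tan_bound, Ht].
- apply is_derive_tan, Rgt_not_eq, cos_gt_0; lra.
Qed.

Lemma ti2_tan'_mul_sin (t : R) :
  - (PI / 4) < t < PI / 4 -> ti2_tan' t * sin (2 * t) = 2 * t.
Proof.
intros Ht.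
pose proof PI_RGT_0.
rewrite <- (odd_pseries_atan t Ht) at 3.
assert (0 < cos t) by (apply cos_gt_0; lra).
rewrite sin_2a; unfold ti2_tan', odd_pseries.
rewrite tan_sqr_plus_1 by lra; unfold tan; field; lra.
Qed.

Lemma ti2_tan'_0 : ti2_tan' 0 = 1.
Proof.
unfold ti2_tan'; rewrite tan_0.
replace (0 ^ 2) with 0 by ring.
rewrite PSeries_0; unfold atan_coef; simpl; field.
Qed.

Lemma ti2_tan_0 : ti2_tan 0 = 0.
Proof. unfold ti2_tan, odd_pseries; rewrite tan_0; ring. Qed.

(** Abel's theorem at [tan (PI / 4) = 1], where the series is Catalan's. *)
Lemma ti2_tan_lim : filterlim ti2_tan (at_left (PI / 4)) (locally catalan).
Proof.
pose proof PI_RGT_0.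
assert (Hc : catalan = 1 * PSeries catalan_term 1).
{ rewrite Rmult_1_l; unfold catalan, PSeries; apply Series_ext.
  intros k; rewrite pow1; ring. }
rewrite Hc.
assert (Ht : filterlim tan (at_left (PI / 4)) (locally 1)).
{ apply (filterlim_filter_le_1 (F := locally (PI / 4)));
    [apply filter_le_within |].
  rewrite <- tan_PI4.
  apply (ex_derive_continuous (K := R_AbsRing) (V := R_NormedModule) tan).
  eexists; apply is_derive_tan, Rgt_not_eq, cos_gt_0; lra. }
unfold ti2_tan, odd_pseries.
apply (filterlim_comp_2 (F := at_left (PI / 4)) (G := locally 1)
  (H := locally (PSeries catalan_term 1)) tan
  (fun t => PSeries catalan_term (tan t ^ 2)) Rmult); [exact Ht | |].
- apply (filterlim_comp _ _ _ (fun t => tan t ^ 2) (PSeries catalan_term)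
    _ (at_left 1)).
  + intros P [d Hd]; unfold filtermap.
    assert (Hs : filterlim (fun t => tan t ^ 2) (at_left (PI / 4)) (locally 1)).
    { apply (filterlim_comp _ _ _ tan (fun x => x ^ 2) _ (locally 1));
        [exact Ht |].
      replace 1 with (1 ^ 2) at 2 by ring.
      apply (ex_derive_continuous (K := R_AbsRing) (V := R_NormedModule)
               (fun x => x ^ 2)).
      auto_derive; trivial. }
    assert (Hp : at_left (PI / 4) (fun t => - (PI / 4) < t < PI / 4)).
    { exists (mkposreal _ PI2_RGT_0); intros t Hb Hlt.
      change (Rabs (t - PI / 4) < PI / 2) in Hb.
      apply Rabs_def2 in Hb; lra. }
    generalize (filter_and _ _ Hp (Hs _ (locally_ball 1 d))).
    apply filter_imp; intros t [H1 H2].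
    apply Hd; [exact H2 |].
    exact (proj1 (Rabs_def2 _ _ (Rabs_sqr_lt_1 _ (tan_bound t H1)))).
  + pose proof (Abel catalan_term) as HA.
    rewrite CV_radius_catalan_term in HA; apply HA; simpl; try lra; [].
    apply (ex_series_ext catalan_term); [| apply ex_series_catalan_term].
    intros k; rewrite pow_n_pow, pow1; symmetry; apply Rmult_1_l.
- apply (filterlim_mult (K := R_AbsRing)).
Qed.

(** * Series with central binomial coefficients *)

Definition asin_coef (k : nat) : R :=
  4 ^ k / ((2 * INR k + 1) * Binomial.C (2 * k) k).

Lemma central_binomial_eq (k : nat) :
  Binomial.C (2 * k) k = INR (fact (2 * k)) / INR (fact k) ^ 2.
Proof.
unfold Binomial.C; replace (2 * k - k)%nat with k by lia.
f_equal; ring.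
Qed.

Lemma central_binomial_pos (k : nat) : 0 < Binomial.C (2 * k) k.
Proof.
rewrite central_binomial_eq.
apply Rdiv_lt_0_compat; [| apply pow_lt]; apply INR_fact_lt_0.
Qed.

Lemma asin_coef_0 : asin_coef 0 = 1.
Proof. unfold asin_coef, Binomial.C; simpl; field. Qed.

(** This is [(2 k + 3) c (k + 1) = (2 k + 2) c k]: the ratio of consecutive
    coefficients is below [1], and the recurrence is what makes the series
    satisfy a first-order differential equation. *)
Lemma asin_coef_S (k : nat) :
  odd_derive asin_coef (S k) = (2 * INR k + 2) * asin_coef k.
Proof.
pose proof (odd_index_ge_1 k).
unfold odd_derive, asin_coef; rewrite !central_binomial_eq.
replace (2 * S k)%nat with (S (S (2 * k))) by lia.
rewrite !fact_simpl, !mult_INR, !S_INR, mult_INR.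
pose proof (INR_fact_neq_0 k); pose proof (INR_fact_neq_0 (2 * k)).
change (INR 2) with 2; change (4 ^ S k) with (4 * 4 ^ k).
field; repeat split; lra || assumption.
Qed.

Lemma asin_coef_bounds (k : nat) : 0 <= asin_coef k <= 1.
Proof.
induction k as [| k IH].
- rewrite asin_coef_0; lra.
- pose proof (asin_coef_S k) as H; unfold odd_derive in H.
  pose proof (odd_index_ge_1 k); rewrite S_INR in H.
  split; nra.
Qed.

Lemma CV_radius_asin_coef : Rbar_le 1 (CV_radius asin_coef).
Proof.
apply (CV_radius_ge_1_of_bounded _ 1); intros k.
pose proof (asin_coef_bounds k); rewrite Rabs_pos_eq; lra.
Qed.

(** With [V y = odd_pseries asin_coef y], this is the equation
    [(1 - y ^ 2) V' = 1 + y V] at [z = y ^ 2]; on coefficients it says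
    [e (k + 1) = e k + c k] for [e k = (2 k + 1) c k]. *)
Lemma odd_pseries_asin_ode (z : R) :
  Rabs z < 1 ->
  (1 - z) * PSeries (odd_derive asin_coef) z = 1 + z * PSeries asin_coef z.
Proof.
intros Hz.
pose proof CV_radius_asin_coef as Hr.
pose proof (ex_pseries_odd_derive _ _ Hr Hz) as Hex.
pose proof (PSeries_decr_1 (odd_derive asin_coef) z Hex) as H.
rewrite (PSeries_ext (PS_decr_1 _) (PS_plus (odd_derive asin_coef) asin_coef)),
  PSeries_plus in H.
- unfold odd_derive at 2 in H; rewrite asin_coef_0 in H; simpl in H; lra.
- exact Hex.
- apply CV_radius_inside, in_disk; assumption.
- intros k; unfold PS_decr_1, PS_plus; rewrite asin_coef_S.
  unfold odd_derive, plus; simpl; ring.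
Qed.

Lemma sin_bound (t : R) : - (PI / 2) < t < PI / 2 -> -1 < sin t < 1.
Proof.
intros Ht.
assert (Hl : sin (- (PI / 2)) < sin t) by (apply sin_increasing_1; lra).
assert (Hr : sin t < sin (PI / 2)) by (apply sin_increasing_1; lra).
rewrite sin_neg, sin_PI2 in Hl; rewrite sin_PI2 in Hr; lra.
Qed.

(** That is, [V (sin t) = t / cos t].  By the differential equation,
    [V (sin t) * cos t] has derivative
    [(1 - sin t ^ 2) V' (sin t) - sin t * V (sin t) = 1]. *)
Lemma odd_pseries_asin (t : R) :
  - (PI / 2) < t < PI / 2 -> odd_pseries asin_coef (sin t) * cos t = t.
Proof.
intros Ht.
pose proof PI_RGT_0.
apply Rminus_diag_uniq.
transitivity (odd_pseries asin_coef (sin 0) * cos 0 - 0).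
- apply (eq_of_derive_zero
    (fun s => odd_pseries asin_coef (sin s) * cos s - s)
    (- (PI / 2)) (PI / 2)); [| exact Ht | lra].
  intros s Hs.
  pose proof (sin_bound s Hs) as Hb.
  pose proof (is_derive_odd_pseries _ _ CV_radius_asin_coef Hb) as Hd.
  auto_derive.
  + eexists; exact Hd.
  + change (fun x : R => odd_pseries asin_coef x) with (odd_pseries asin_coef).
    rewrite (is_derive_unique _ _ _ Hd).
    pose proof (odd_pseries_asin_ode _ (Rabs_sqr_lt_1 _ Hb)) as Ho.
    pose proof (sin2_cos2 s) as H2; unfold Rsqr in H2.
    unfold odd_pseries in *.
    replace (1 - sin s ^ 2) with (cos s * cos s) in Ho by (rewrite <- H2; ring).
    lra.
- rewrite sin_0; unfold odd_pseries; ring.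
Qed.

(** Integrating [asin y / (y sqrt (1 - y ^ 2))], the series of [asin_coef]
    divided by [y], divides coefficient [k] by one more factor [2 k + 1]. *)
Definition asin_sqr_coef (k : nat) : R :=
  4 ^ k / ((2 * INR k + 1) ^ 2 * Binomial.C (2 * k) k).

Lemma odd_derive_asin_sqr_coef (k : nat) :
  odd_derive asin_sqr_coef k = asin_coef k.
Proof.
pose proof (odd_index_ge_1 k); pose proof (central_binomial_pos k).
unfold odd_derive, asin_sqr_coef, asin_coef; field; lra.
Qed.

Lemma CV_radius_asin_sqr_coef : Rbar_le 1 (CV_radius asin_sqr_coef).
Proof.
apply (CV_radius_ge_1_of_bounded _ 1); intros k.
pose proof (odd_derive_asin_sqr_coef k) as H; unfold odd_derive in H.
pose proof (asin_coef_bounds k); pose proof (odd_index_ge_1 k).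
apply Rabs_le; split; nra.
Qed.

(** Both sides have derivative [t / sin t] and vanish at [0]. *)
Lemma odd_pseries_asin_sqr (t : R) :
  - (PI / 2) < t < PI / 2 ->
  odd_pseries asin_sqr_coef (sin t) = 2 * ti2_tan (t / 2).
Proof.
intros Ht.
pose proof PI_RGT_0.
apply Rminus_diag_uniq.
transitivity (odd_pseries asin_sqr_coef (sin 0) - 2 * ti2_tan (0 / 2)).
- apply (eq_of_derive_zero
    (fun s => odd_pseries asin_sqr_coef (sin s) - 2 * ti2_tan (s / 2))
    (- (PI / 2)) (PI / 2)); [| exact Ht | lra].
  intros s Hs.
  pose proof (sin_bound s Hs) as Hb.
  pose proof (is_derive_odd_pseries _ _ CV_radius_asin_sqr_coef Hb) as Hd.
  rewrite (PSeries_ext _ _ _ odd_derive_asin_sqr_coef) in Hd.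
  assert (Hh : - (PI / 4) < s / 2 < PI / 4) by lra.
  pose proof (is_derive_ti2_tan _ Hh) as Ha.
  auto_derive.
  + split; [eexists; exact Hd | split; [eexists; exact Ha | trivial]].
  + change (fun x : R => odd_pseries asin_sqr_coef x)
      with (odd_pseries asin_sqr_coef).
    change (fun x : R => ti2_tan x) with ti2_tan.
    rewrite (is_derive_unique _ _ _ Hd).
    replace (s * / 2) with (s / 2) by field.
    rewrite (is_derive_unique _ _ _ Ha).
    (* At s = 0 the value s / sin s is not available, and both derivatives
       are read off the constant terms of their power series. *)
    destruct (Req_dec s 0) as [-> | Hs0].
    * replace (0 / 2) with 0 by field.
      rewrite ti2_tan'_0, sin_0, cos_0.
      replace (0 ^ 2) with 0 by ring.
      rewrite PSeries_0, asin_coef_0; field.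
    * pose proof (odd_pseries_asin s Hs) as Hv; unfold odd_pseries in Hv.
      pose proof (ti2_tan'_mul_sin _ Hh) as Hg.
      replace (2 * (s / 2)) with s in Hg by field.
      apply Rmult_eq_reg_l with (sin s); [lra |].
      intros Hz; rewrite Hz in Hv; lra.
- replace (0 / 2) with 0 by field.
  rewrite sin_0, ti2_tan_0; unfold odd_pseries; ring.
Qed.

(** * Partial fractions of 5 / sin (5 x) *)

(** From [cos (3 a) = sin (2 a)] at [a = PI / 10], divided by [cos a]. *)
Lemma sin_PI10_quadratic : 4 * sin (PI / 10) ^ 2 + 2 * sin (PI / 10) = 1.
Proof.
pose proof PI_RGT_0.
assert (Hc : 0 < cos (PI / 10)) by (apply cos_gt_0; lra).
assert (H3 : cos (3 * (PI / 10)) = sin (2 * (PI / 10))).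
{ rewrite <- sin_shift; f_equal; field. }
replace (3 * (PI / 10)) with (2 * (PI / 10) + PI / 10) in H3 by ring.
rewrite cos_plus, cos_2a_sin, sin_2a in H3.
pose proof (sin2_cos2 (PI / 10)) as H2; unfold Rsqr in H2.
nra.
Qed.

Lemma sin_PI10_pos : 0 < sin (PI / 10).
Proof. pose proof PI_RGT_0; apply sin_gt_0; lra. Qed.

Lemma cos_PI5_eq : cos (PI / 5) = sin (PI / 10) + 1 / 2.
Proof.
replace (PI / 5) with (2 * (PI / 10)) by field.
rewrite cos_2a_sin; pose proof sin_PI10_quadratic; lra.
Qed.

Lemma sin_3PI10_eq : sin (3 * PI / 10) = sin (PI / 10) + 1 / 2.
Proof.
rewrite <- cos_PI5_eq, <- sin_shift; f_equal; field.
Qed.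

Lemma cos_2PI5_eq : cos (2 * PI / 5) = sin (PI / 10).
Proof. rewrite <- sin_shift; f_equal; field. Qed.

Lemma sin_5a (x : R) :
  sin (5 * x) = sin x * (5 - 20 * sin x ^ 2 + 16 * sin x ^ 4).
Proof.
replace (5 * x) with (2 * x + (2 * x + x)) by ring.
rewrite !sin_plus, !cos_plus, sin_2a, cos_2a_sin.
pose proof (sin2_cos2 x) as H2; unfold Rsqr in H2.
cbn [pow]; nsatz.
Qed.

Lemma sin_plus_mul_sin_minus (a x : R) :
  sin (a + x) * sin (a - x) = sin a ^ 2 - sin x ^ 2.
Proof.
rewrite sin_plus, sin_minus.
pose proof (sin2_cos2 a) as Ha; unfold Rsqr in Ha.
pose proof (sin2_cos2 x) as Hx; unfold Rsqr in Hx.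
cbn [pow]; nsatz.
Qed.

Lemma inv_sin_plus_sub_inv_sin_minus (a x : R) :
  sin (a + x) <> 0 -> sin (a - x) <> 0 ->
  / sin (a + x) - / sin (a - x)
  = - 2 * cos a * sin x / (sin a ^ 2 - sin x ^ 2).
Proof.
intros Hp Hm.
rewrite <- sin_plus_mul_sin_minus.
assert (H : sin (a - x) - sin (a + x) = - 2 * cos a * sin x)
  by (rewrite sin_plus, sin_minus; ring).
rewrite <- H; field; auto.
Qed.

(** The polynomial [sin (5 x) / sin x] in [s = sin x] has the roots
    [sin (PI / 5)] and [sin (2 PI / 5)] up to sign, so it is
    [16 (sin (2 PI / 5) ^ 2 - s ^ 2) (sin (PI / 5) ^ 2 - s ^ 2)].  The identity is
    then a relation between rational functions of [s] and [r = sin (PI / 10)],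
    valid modulo [4 r ^ 2 + 2 r = 1]. *)
Lemma inv_sin_5a (x : R) :
  - (PI / 10) < x < PI / 10 -> x <> 0 ->
  5 / sin (5 * x) =
  / sin x + (/ sin (2 * PI / 5 + x) - / sin (2 * PI / 5 - x))
          - (/ sin (PI / 5 + x) - / sin (PI / 5 - x)).
Proof.
intros Hx Hx0.
pose proof PI_RGT_0.
assert (Hs : sin x <> 0).
{ destruct (Rlt_or_le 0 x) as [Hp | Hn].
  - apply Rgt_not_eq, sin_gt_0; lra.
  - apply Rlt_not_eq, sin_lt_0_var; lra. }
assert (Ha1 : 0 < sin (2 * PI / 5 + x)) by (apply sin_gt_0; lra).
assert (Ha2 : 0 < sin (2 * PI / 5 - x)) by (apply sin_gt_0; lra).
assert (Hb1 : 0 < sin (PI / 5 + x)) by (apply sin_gt_0; lra).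
assert (Hb2 : 0 < sin (PI / 5 - x)) by (apply sin_gt_0; lra).
rewrite !inv_sin_plus_sub_inv_sin_minus by lra.
pose proof (Rmult_lt_0_compat _ _ Ha1 Ha2) as Ha.
pose proof (Rmult_lt_0_compat _ _ Hb1 Hb2) as Hb.
rewrite sin_plus_mul_sin_minus in Ha, Hb.
pose proof sin_PI10_quadratic as Hr.
pose proof (sin2_cos2 (2 * PI / 5)) as Hsa; unfold Rsqr in Hsa.
pose proof (sin2_cos2 (PI / 5)) as Hsb; unfold Rsqr in Hsb.
rewrite cos_2PI5_eq in *; rewrite cos_PI5_eq in *.
set (r := sin (PI / 10)) in *; set (s := sin x) in *.
replace (sin (2 * PI / 5) ^ 2) with ((3 + 2 * r) / 4) in * by lra.
replace (sin (PI / 5) ^ 2) with ((1 - r) / 2) in * by lra.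
(* P and Q below are the two quadratic factors, rewritten linearly in r. *)
assert (H5 : sin (5 * x) =
             16 * (s * ((3 + 2 * r) / 4 - s ^ 2) * ((1 - r) / 2 - s ^ 2))).
{ rewrite sin_5a; fold s; apply Rminus_diag_uniq.
  transitivity (s * (4 * r ^ 2 + 2 * r - 1)); [field | rewrite Hr; ring]. }
assert (Hnum : 16 * (((3 + 2 * r) / 4 - s ^ 2) * ((1 - r) / 2 - s ^ 2))
               + 32 * s ^ 2 * ((r + 1 / 2) * ((3 + 2 * r) / 4 - s ^ 2)
                               - r * ((1 - r) / 2 - s ^ 2)) = 5).
{ apply Rminus_diag_uniq.
  transitivity ((8 * s ^ 2 - 1) * (4 * r ^ 2 + 2 * r - 1));
    [field | rewrite Hr; ring]. }
rewrite H5; revert Ha Hb Hnum.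
generalize ((3 + 2 * r) / 4 - s ^ 2) ((1 - r) / 2 - s ^ 2).
intros P Q HP HQ Hnum.
rewrite <- Hnum; field; repeat split; lra.
Qed.

(** * The relation between angles t and 5 t *)

Definition ln_tan (t : R) : R := ln (tan t).

Lemma is_derive_ln_tan (t : R) :
  0 < t < PI / 2 -> is_derive ln_tan t (2 * / sin (2 * t)).
Proof.
intros Ht.
pose proof (sin_gt_0 t ltac:(lra) ltac:(lra)) as Hs.
pose proof (cos_gt_0 t ltac:(lra) ltac:(lra)) as Hc.
replace (2 * / sin (2 * t)) with ((tan t ^ 2 + 1) * / tan t).
- apply (is_derive_comp (K := R_AbsRing) (V := R_NormedModule) ln tan).
  + apply is_derive_Reals, derivable_pt_lim_ln, tan_gt_0; lra.
  + apply is_derive_tan; lra.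
- rewrite sin_2a, tan_sqr_plus_1 by lra; unfold tan; field; lra.
Qed.

Lemma ti2_tan'_eq (t : R) :
  - (PI / 4) < t < PI / 4 -> t <> 0 -> ti2_tan' t = 2 * t * / sin (2 * t).
Proof.
intros Ht Ht0.
pose proof (ti2_tan'_mul_sin t Ht) as H.
assert (Hs : sin (2 * t) <> 0) by (intros Hz; rewrite Hz in H; lra).
apply Rmult_eq_reg_r with (sin (2 * t)); [rewrite H; field |]; exact Hs.
Qed.

(** The part of the relation that stays differentiable at [PI / 20], where the
    two other terms reach the end point [PI / 4].  In the derivative of a term
    [ti2_tan (a + t)], equal to [2 (a + t) / sin (2 (a + t))], the
    logarithm with factor [a] cancels the share of [2 a]; a common factor [2 t]
    is left, times the partial fractions of [inv_sin_5a] at [2 t]. *)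
Definition quintuple_rest (t : R) : R :=
  ti2_tan (PI / 5 - t) - ti2_tan t
  + ti2_tan (PI / 10 + t) - ti2_tan (PI / 10 - t)
  + PI / 5 * (ln_tan (PI / 5 + t) - ln_tan (PI / 5 - t))
  + PI / 10 * (ln_tan (PI / 10 - t) - ln_tan (PI / 10 + t)).

Definition quintuple_rest' (t : R) : R :=
  - ti2_tan' (PI / 5 - t) - ti2_tan' t
  + ti2_tan' (PI / 10 + t) + ti2_tan' (PI / 10 - t)
  + 2 * PI / 5 * (/ sin (2 * (PI / 5 + t)) + / sin (2 * (PI / 5 - t)))
  - PI / 5 * (/ sin (2 * (PI / 10 - t)) + / sin (2 * (PI / 10 + t))).

Lemma is_derive_quintuple_rest (t : R) :
  - (PI / 20) < t < PI / 10 ->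
  is_derive quintuple_rest t (quintuple_rest' t).
Proof.
intros Ht.
pose proof PI_RGT_0.
pose proof (is_derive_ti2_tan (PI / 5 - t) ltac:(lra)) as A1.
pose proof (is_derive_ti2_tan t ltac:(lra)) as A2.
pose proof (is_derive_ti2_tan (PI / 10 + t) ltac:(lra)) as A3.
pose proof (is_derive_ti2_tan (PI / 10 - t) ltac:(lra)) as A4.
pose proof (is_derive_ln_tan (PI / 5 + t) ltac:(lra)) as L1.
pose proof (is_derive_ln_tan (PI / 5 - t) ltac:(lra)) as L2.
pose proof (is_derive_ln_tan (PI / 10 - t) ltac:(lra)) as L3.
pose proof (is_derive_ln_tan (PI / 10 + t) ltac:(lra)) as L4.
unfold quintuple_rest, quintuple_rest', Rminus in *.
auto_derive.
- repeat split; eexists; eassumption.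
- change (fun x : R => ti2_tan x) with ti2_tan.
  change (fun x : R => ln_tan x) with ln_tan.
  rewrite (is_derive_unique _ _ _ A1), (is_derive_unique _ _ _ A2),
    (is_derive_unique _ _ _ A3), (is_derive_unique _ _ _ A4),
    (is_derive_unique _ _ _ L1), (is_derive_unique _ _ _ L2),
    (is_derive_unique _ _ _ L3), (is_derive_unique _ _ _ L4).
  lra.
Qed.

Lemma quintuple_relation (t : R) :
  - (PI / 20) < t < PI / 20 ->
  ti2_tan (PI / 5 + t) - / 5 * ti2_tan (5 * t) = quintuple_rest t.
Proof.
intros Ht.
pose proof PI_RGT_0.
apply Rminus_diag_uniq.
transitivity (ti2_tan (PI / 5 + 0) - / 5 * ti2_tan (5 * 0) - quintuple_rest 0).
- apply (eq_of_derive_zero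
    (fun s => ti2_tan (PI / 5 + s) - / 5 * ti2_tan (5 * s) - quintuple_rest s)
    (- (PI / 20)) (PI / 20)); [| exact Ht | lra].
  clear t Ht; intros t Ht.
  pose proof (is_derive_ti2_tan (5 * t) ltac:(lra)) as A1.
  pose proof (is_derive_ti2_tan (PI / 5 + t) ltac:(lra)) as A2.
  pose proof (is_derive_quintuple_rest t ltac:(lra)) as A3.
  auto_derive.
  + repeat split; eexists; eassumption.
  + change (fun x : R => ti2_tan x) with ti2_tan.
    change (fun x : R => quintuple_rest x) with quintuple_rest.
    rewrite (is_derive_unique _ _ _ A1), (is_derive_unique _ _ _ A2),
      (is_derive_unique _ _ _ A3).
    unfold quintuple_rest'.
    rewrite (ti2_tan'_eq (PI / 5 + t)), (ti2_tan'_eq (PI / 5 - t)),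
      (ti2_tan'_eq (PI / 10 + t)), (ti2_tan'_eq (PI / 10 - t)) by lra.
    (* At t = 0 the terms in t and 5 t cancel each other, as ti2_tan' 0
       appears with the factors 1 and -1. *)
    destruct (Req_dec t 0) as [-> | Ht0].
    * replace (5 * 0) with 0 by ring.
      rewrite !Rplus_0_r, !Rminus_0_r; lra.
    * rewrite (ti2_tan'_eq (5 * t)), (ti2_tan'_eq t) by lra.
      pose proof (inv_sin_5a (2 * t) ltac:(lra) ltac:(lra)) as Hp.
      replace (2 * (5 * t)) with (5 * (2 * t)) by ring.
      replace (2 * (PI / 5 + t)) with (2 * PI / 5 + 2 * t) by field.
      replace (2 * (PI / 5 - t)) with (2 * PI / 5 - 2 * t) by field.
      replace (2 * (PI / 10 + t)) with (PI / 5 + 2 * t) by field.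
      replace (2 * (PI / 10 - t)) with (PI / 5 - 2 * t) by field.
      apply (f_equal (Rmult (2 * t))) in Hp; lra.
- unfold quintuple_rest; replace (5 * 0) with 0 by ring.
  rewrite !Rplus_0_r, !Rminus_0_r, ti2_tan_0; lra.
Qed.

Lemma filterlim_affine_at_left (a b x : R) :
  0 < a -> filterlim (fun t => b + a * t) (at_left x) (at_left (b + a * x)).
Proof.
intros Ha P [d Hd].
exists (mkposreal (d / a) (Rdiv_lt_0_compat _ _ (cond_pos d) Ha)).
intros t Ht Hlt; apply Hd.
- change (Rabs (t - x) < d / a) in Ht.
  change (Rabs (b + a * t - (b + a * x)) < d).
  replace (b + a * t - (b + a * x)) with (a * (t - x)) by ring.
  rewrite Rabs_mult, (Rabs_pos_eq a) by lra.
  apply Rmult_lt_compat_l with (r := a) in Ht; [| exact Ha].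
  replace (a * (d / a)) with (pos d) in Ht by (field; lra); exact Ht.
- nra.
Qed.

(** The limit of [quintuple_relation] as [t] tends to [PI / 20] from the left;
    the limit is one-sided because the series of [ti2_tan] diverges beyond
    [PI / 4]. *)
Lemma catalan_ti2_tan :
  catalan = 5 / 2 * (ti2_tan (3 * PI / 20) - ti2_tan (PI / 20))
            + PI / 8 * (ln_tan (PI / 20) - 3 * ln_tan (3 * PI / 20)).
Proof.
pose proof PI_RGT_0.
assert (Hlim : filterlim
  (fun t => ti2_tan (PI / 5 + 1 * t) + - / 5 * ti2_tan (0 + 5 * t))
  (at_left (PI / 20)) (locally (catalan + - / 5 * catalan))).
{ apply (filterlim_comp_2 (F := at_left (PI / 20)) (G := locally catalan)
    (H := locally (- / 5 * catalan)) (fun t => ti2_tan (PI / 5 + 1 * t))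
    (fun t => - / 5 * ti2_tan (0 + 5 * t)) Rplus).
  - apply (filterlim_comp _ _ _ (fun t => PI / 5 + 1 * t) ti2_tan
      _ (at_left (PI / 4))); [| exact ti2_tan_lim].
    replace (PI / 4) with (PI / 5 + 1 * (PI / 20)) by field.
    apply filterlim_affine_at_left; lra.
  - apply (filterlim_comp _ _ _ (fun t => ti2_tan (0 + 5 * t)) (Rmult (- / 5))
      _ (locally catalan)).
    + apply (filterlim_comp _ _ _ (fun t => 0 + 5 * t) ti2_tan
        _ (at_left (PI / 4))); [| exact ti2_tan_lim].
      replace (PI / 4) with (0 + 5 * (PI / 20)) by field.
      apply filterlim_affine_at_left; lra.
    + apply (filterlim_scal_r (K := R_AbsRing) (V := R_NormedModule)).
  - apply (filterlim_plus (K := R_AbsRing) (V := R_NormedModule)). }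
assert (Hrest : filterlim quintuple_rest (at_left (PI / 20))
                  (locally (quintuple_rest (PI / 20)))).
{ apply (filterlim_filter_le_1 (F := locally (PI / 20)));
    [apply filter_le_within |].
  apply (ex_derive_continuous (K := R_AbsRing) (V := R_NormedModule)
           quintuple_rest).
  eexists; apply is_derive_quintuple_rest; lra. }
assert (Heq : catalan + - / 5 * catalan = quintuple_rest (PI / 20)).
{ apply (filterlim_locally_unique (F := at_left (PI / 20)) quintuple_rest);
    [| exact Hrest].
  apply filterlim_ext_loc with (2 := Hlim).
  assert (Hd : 0 < PI / 10) by lra.
  exists (mkposreal _ Hd); intros t Hb Hlt.
  change (Rabs (t - PI / 20) < PI / 10) in Hb.
  apply Rabs_def2 in Hb.
  rewrite <- quintuple_relation by lra.
  rewrite Rmult_1_l, Rplus_0_l; ring. }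
unfold quintuple_rest in Heq.
replace (PI / 5 - PI / 20) with (3 * PI / 20) in Heq by field.
replace (PI / 10 + PI / 20) with (3 * PI / 20) in Heq by field.
replace (PI / 10 - PI / 20) with (PI / 20) in Heq by field.
replace (PI / 5 + PI / 20) with (PI / 4) in Heq by field.
unfold ln_tan at 1 in Heq; rewrite tan_PI4, ln_1 in Heq.
lra.
Qed.

(** * Evaluation of the logarithm *)

Lemma sqrt5_sqr : sqrt 5 ^ 2 = 5.
Proof. apply pow2_sqrt; lra. Qed.

Lemma sin_PI10 : sin (PI / 10) = (sqrt 5 - 1) / 4.
Proof.
pose proof sin_PI10_quadratic; pose proof sin_PI10_pos.
pose proof sqrt5_sqr; pose proof (sqrt_lt_R0 5 ltac:(lra)).
nra.
Qed.

Lemma tan_half (t : R) :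
  0 < t < PI / 2 -> tan t = (1 - cos (2 * t)) / sin (2 * t).
Proof.
intros Ht.
pose proof (sin_gt_0 t ltac:(lra) ltac:(lra)) as Hs.
pose proof (cos_gt_0 t ltac:(lra) ltac:(lra)) as Hc.
rewrite sin_2a, cos_2a_sin; unfold tan; field; lra.
Qed.

(** The nested radical lies in the field generated by [sqrt 5] and
    [cos (PI / 10)]: [(50 - 22 sqrt 5) / cos (PI / 10) ^ 2] is the square of
    [4 sqrt 5 - 8]. *)
Lemma sqrt_cos_PI10 :
  sqrt (50 - 22 * sqrt 5) = (4 * sqrt 5 - 8) * cos (PI / 10).
Proof.
pose proof PI_RGT_0.
pose proof sqrt5_sqr as H5; pose proof (sqrt_lt_R0 5 ltac:(lra)).
assert (Hc : 0 < cos (PI / 10)) by (apply cos_gt_0; lra).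
pose proof (sin2_cos2 (PI / 10)) as H2; unfold Rsqr in H2.
rewrite sin_PI10 in H2.
apply sqrt_lem_1; [nra | apply Rmult_le_pos; nra |].
transitivity ((4 * sqrt 5 - 8) ^ 2 * (cos (PI / 10) * cos (PI / 10))); [ring |].
replace (cos (PI / 10) * cos (PI / 10))
  with (1 - (sqrt 5 - 1) / 4 * ((sqrt 5 - 1) / 4)) by lra.
nra.
Qed.

Lemma cos_3PI10_eq :
  cos (3 * PI / 10) = (sqrt 5 - 1) / 2 * cos (PI / 10).
Proof.
rewrite <- sin_shift.
replace (PI / 2 - 3 * PI / 10) with (2 * (PI / 10)) by field.
rewrite sin_2a, sin_PI10; field.
Qed.

(** By the half-angle formula both tangents are rational in [q = sqrt 5] and
    [c = cos (PI / 10)], so the claim is polynomial modulo [q ^ 2 = 5] and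
    [8 c ^ 2 = 5 + q]. *)
Lemma tan_PI20_div_cube :
  tan (PI / 20) / tan (3 * PI / 20) ^ 3
  = (10 + sqrt (50 - 22 * sqrt 5)) / (10 - sqrt (50 - 22 * sqrt 5)).
Proof.
pose proof PI_RGT_0.
rewrite sqrt_cos_PI10, !tan_half by lra.
replace (2 * (PI / 20)) with (PI / 10) by field.
replace (2 * (3 * PI / 20)) with (3 * PI / 10) by field.
rewrite cos_3PI10_eq, sin_3PI10_eq.
assert (Hc : 0 < cos (PI / 10)) by (apply cos_gt_0; lra).
pose proof (sin2_cos2 (PI / 10)) as H2; unfold Rsqr in H2.
rewrite sin_PI10 in *.
pose proof sqrt5_sqr as H5; pose proof (sqrt_lt_R0 5 ltac:(lra)).
set (q := sqrt 5) in *; set (c := cos (PI / 10)) in *.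
assert (Hq : 2 < q < 3) by nra.
assert (Hc2 : c * c = (5 + q) / 8) by nra.
assert (Hc1 : c < 1) by nra.
field_simplify_eq.
- clearbody q c.
  assert (Hc8 : 8 * (c * c) = 5 + q) by lra.
  assert (Hqq : q * q = 5) by lra.
  clear - Hc8 Hqq; cbn [pow]; nsatz.
- repeat split; nra.
Qed.

Lemma ln_tan_PI20 :
  ln_tan (PI / 20) - 3 * ln_tan (3 * PI / 20)
  = ln ((10 + sqrt (50 - 22 * sqrt 5)) / (10 - sqrt (50 - 22 * sqrt 5))).
Proof.
pose proof PI_RGT_0.
assert (0 < tan (PI / 20)) by (apply tan_gt_0; lra).
assert (0 < tan (3 * PI / 20)) by (apply tan_gt_0; lra).
rewrite <- tan_PI20_div_cube, ln_div by (try apply pow_lt; assumption).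
rewrite ln_pow by assumption; unfold ln_tan; simpl; ring.
Qed.

(** * The Lucas series *)

Lemma lucas_binet (n : nat) (p q : R) :
  p + q = 1 -> p * q = -1 -> INR (lucas n) = p ^ n + q ^ n.
Proof.
intros Hs Hp.
enough (H : INR (lucas n) = p ^ n + q ^ n
            /\ INR (lucas (S n)) = p ^ S n + q ^ S n) by apply H.
induction n as [| n [IH1 IH2]]; [simpl; lra |].
split; [exact IH2 |].
change (lucas (S (S n))) with (lucas (S n) + lucas n)%nat.
rewrite plus_INR, IH1, IH2; simpl.
replace q with (1 - p) in * by lra.
replace (p * (p * p ^ n)) with ((p * p) * p ^ n) by ring.
replace (p * p) with (p + 1) by lra.
replace ((1 - p) * ((1 - p) * (1 - p) ^ n))
  with ((1 - 2 * p + p * p) * (1 - p) ^ n) by ring.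
replace (p * p) with (p + 1) by lra.
ring.
Qed.

(** The two terms of Binet's formula are powers of [2 sin (3 PI / 10)] and of
    [- 2 sin (PI / 10)]; odd exponents make the second a difference. *)
Lemma is_series_lucas_term :
  is_series lucas_term
    (4 * (ti2_tan (3 * PI / 20) - ti2_tan (PI / 20))).
Proof.
pose proof PI_RGT_0.
set (r := sin (PI / 10)).
assert (Hterm : forall t, - (PI / 2) < t < PI / 2 ->
  is_series (fun k => 2 * sin t * (asin_sqr_coef k * (sin t ^ 2) ^ k))
    (4 * ti2_tan (t / 2))).
{ intros t Ht.
  replace (4 * ti2_tan (t / 2))
    with (2 * sin t * PSeries asin_sqr_coef (sin t ^ 2)).
  - apply (is_series_scal (K := R_AbsRing) (V := R_NormedModule) (2 * sin t)
      (fun k => asin_sqr_coef k * (sin t ^ 2) ^ k)).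
    apply Series_correct, ex_pseries_R, CV_radius_inside, in_disk.
    + apply CV_radius_asin_sqr_coef.
    + apply Rabs_sqr_lt_1, sin_bound, Ht.
  - pose proof (odd_pseries_asin_sqr t Ht) as H1; unfold odd_pseries in H1; lra. }
pose proof (is_series_minus (K := R_AbsRing) (V := R_NormedModule) _ _ _ _
  (Hterm (3 * PI / 10) ltac:(lra)) (Hterm (PI / 10) ltac:(lra))) as Hm.
replace (3 * PI / 10 / 2) with (3 * PI / 20) in Hm by field.
replace (PI / 10 / 2) with (PI / 20) in Hm by field.
replace (4 * (ti2_tan (3 * PI / 20) - ti2_tan (PI / 20)))
  with (4 * ti2_tan (3 * PI / 20) - 4 * ti2_tan (PI / 20)) by ring.
apply is_series_ext with (2 := Hm).
intros k.
pose proof sin_PI10_quadratic as Hr.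
rewrite sin_3PI10_eq; fold r; fold r in Hr.
unfold lucas_term, asin_sqr_coef.
rewrite (lucas_binet _ (2 * (r + 1 / 2)) (- (2 * r))) by lra.
change (2 * (r + 1 / 2) * (4 ^ k / ((2 * INR k + 1) ^ 2 * Binomial.C (2 * k) k)
                           * ((r + 1 / 2) ^ 2) ^ k)
        - 2 * r * (4 ^ k / ((2 * INR k + 1) ^ 2 * Binomial.C (2 * k) k)
                   * (r ^ 2) ^ k)
        = ((2 * (r + 1 / 2)) ^ (2 * k + 1) + (- (2 * r)) ^ (2 * k + 1))
          / ((2 * INR k + 1) ^ 2 * Binomial.C (2 * k) k)).
assert (Hpow : forall x, x ^ (2 * k + 1) = x * (x ^ 2) ^ k).
{ intros x; rewrite pow_add, pow_mult; ring. }
rewrite !Hpow.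
replace ((2 * (r + 1 / 2)) ^ 2) with (4 * (r + 1 / 2) ^ 2) by ring.
replace ((- (2 * r)) ^ 2) with (4 * r ^ 2) by ring.
rewrite !Rpow_mult_distr; unfold Rdiv; ring.
Qed.

Theorem corollary1 :
  ex_series lucas_term /\
  catalan =
    PI / 8 * ln ((10 + sqrt (50 - 22 * sqrt 5)) / (10 - sqrt (50 - 22 * sqrt 5)))
    + 5 / 8 * Series lucas_term.
Proof.
split; [eexists; exact is_series_lucas_term |].
rewrite (is_series_unique _ _ is_series_lucas_term), catalan_ti2_tan, ln_tan_PI20.
field.
Qed.
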